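(* Let $c\in\mathbb{C}\setminus\{0\}$ and let $F\in C^\infty(S^1,\mathbb{C})$, $S^1=\mathbb{R}/\mathbb{Z}$. If $|F|\leq|c|<\frac{3}{10}$, then there exists $f\in C^\infty(S^1,\mathbb{R})$, unique up to an additive constant, such that $$1+f''>0,\qquad (1+f'')|c|^2+|F|^2<|c|,$$ $$\left(\frac{(1+f'')|c|^2+|F|^2}{1+\sqrt{1-\frac{1}{|c|^2}\left((1+f'')|c|^2+|F|^2\right)^2}}-(1+f'')\right)''=0 .$$
   Context: Primes denote derivatives with respect to the variable $y^1\in S^1$. (The last equation is the real moment map equation of the HcscK system on $\mathbb{C}^2/(\mathbb{Z}^2+\mathrm{i}\mathbb{Z}^2)$ for the symplectic potential $u=\frac12|\boldsymbol y|^2+f(y^1)$ and the Higgs tensor $\xi=\begin{pmatrix} c & F \\ F & F^2/c \end{pmatrix}$; the second condition is $\|\xi\|_u^2<1$.) *)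

(* Defs.v *)
From Stdlib Require Import Reals.
From Coquelicot Require Import Coquelicot.
Open Scope R_scope.

(** Functions on [S^1 = R/Z] are encoded as 1-periodic functions on [R]. *)
Definition periodic1 {T : Type} (g : R -> T) : Prop :=
  forall y : R, g (y + 1) = g y.

Definition smooth (g : R -> R) : Prop :=
  forall (n : nat) (y : R), ex_derive_n g n y.

Definition circle_smooth (g : R -> R) : Prop :=
  periodic1 g /\ smooth g.

Definition circle_smoothC (g : R -> C) : Prop :=
  periodic1 g /\ smooth (fun y => Re (g y)) /\ smooth (fun y => Im (g y)).

Definition higgs_term (c : C) (F : R -> C) (f : R -> R) (y : R) : R :=
  (1 + Derive_n f 2 y) * (Cmod c) ^ 2 + (Cmod (F y)) ^ 2.

Definition moment_fun (c : C) (F : R -> C) (f : R -> R) (y : R) : R :=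
  higgs_term c F f y
    / (1 + sqrt (1 - 1 / (Cmod c) ^ 2 * (higgs_term c F f y) ^ 2))
  - (1 + Derive_n f 2 y).

(** [Derive_n] is total, but the first two conditions give
    [0 < higgs_term c F f y < Cmod c]: the argument of [sqrt] is positive, so
    [moment_fun c F f] is smooth and the last condition concerns its genuine
    second derivative. *)
Definition moment_map_solution (c : C) (F : R -> C) (f : R -> R) : Prop :=
  circle_smooth f
  /\ (forall y : R, 0 < 1 + Derive_n f 2 y)
  /\ (forall y : R, higgs_term c F f y < Cmod c)
  /\ (forall y : R, Derive_n (moment_fun c F f) 2 y = 0).

(* Main.v *)
(** A periodic function with vanishing second derivative is constant, so the
    equation says that the moment function is a constant [-K]. Write
    [r = |c|] and let [s = tan (theta / 2)], where [r sin theta] is the Higgs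
    term; then the moment function is [r s - (1 + f'')], so
    [1 + f'' = K + r s] and [2 s / (1 + s^2) - r^2 s = r K + |F|^2 / r].
    The left-hand side is strictly increasing in [s] on [[0, 1/2]], and the
    bounds [|F| <= r < 3/10] force [s] into this branch. For existence, solve
    for [s] at each [K] in [[0, 1]] and choose [K] by the intermediate value
    theorem so that [K + r s] has mean 1; integrating twice gives [f]. For
    uniqueness, Rolle's theorem gives a point where two solutions have equal
    second derivatives, hence the same [K], hence the same [s] everywhere. *)

Require Import Defs.
From Stdlib Require Import Reals Lra Psatz ClassicalEpsilon FunctionalExtensionality.
From Coquelicot Require Import Coquelicot.
Open Scope R_scope.

(** * Finite-order smoothness and its closure under algebraic operations *)

(** Unfolding one derivative at a time lets each closure property follow by induction on [n] from
    the matching differentiation rule. *)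
Fixpoint Ck (n : nat) (g : R -> R) : Prop :=
  match n with
  | O => forall x, continuous g x
  | S m => (forall x, ex_derive g x) /\ Ck m (Derive g)
  end.

Lemma Ck_pred n g : Ck (S n) g -> Ck n g.
Proof.
  revert g; induction n as [|n IH]; intros g [Hd Hg].
  - intros x; apply (ex_derive_continuous g), Hd.
  - split; [exact Hd | apply IH, Hg].
Qed.

(** An explicit formula [g'] takes the place of [Derive g], so a function whose derivative is an
    expression in functions already known to be [Ck n] gains one order. *)
Lemma Ck_primitive n g g' :
  (forall x, is_derive g x (g' x)) -> Ck n g' -> Ck (S n) g.
Proof.
  intros Hg Hg'; split.
  - intros x; exists (g' x); apply Hg.
  - replace (Derive g) with g'; [exact Hg'|].
    apply functional_extensionality; intros x.
    symmetry; apply is_derive_unique, Hg.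
Qed.

Lemma Ck_const n k : Ck n (fun _ => k).
Proof.
  revert k; induction n as [|n IH]; intros k.
  - intros x; apply continuous_const.
  - apply (Ck_primitive _ _ (fun _ => 0)); [|apply IH].
    intros x; apply (is_derive_const k).
Qed.

Lemma Ck_plus n f g : Ck n f -> Ck n g -> Ck n (fun x => f x + g x).
Proof.
  revert f g; induction n as [|n IH]; intros f g Hf Hg.
  - intros x; apply (continuous_plus f g); [apply Hf | apply Hg].
  - destruct Hf as [Df Hf], Hg as [Dg Hg].
    apply (Ck_primitive _ _ (fun x => Derive f x + Derive g x)); [|now apply IH].
    intros x; apply (is_derive_plus f g); now apply Derive_correct.
Qed.

Lemma Ck_mult n f g : Ck n f -> Ck n g -> Ck n (fun x => f x * g x).
Proof.
  revert f g; induction n as [|n IH]; intros f g Hf Hg.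
  - intros x; apply (continuous_mult f g); [apply Hf | apply Hg].
  - pose proof (Ck_pred _ _ Hf) as Hf0; pose proof (Ck_pred _ _ Hg) as Hg0.
    destruct Hf as [Df Hf], Hg as [Dg Hg].
    apply (Ck_primitive _ _ (fun x => Derive f x * g x + f x * Derive g x)).
    + intros x; apply (is_derive_mult f g x);
        [now apply Derive_correct | now apply Derive_correct | exact Rmult_comm].
    + apply Ck_plus; now apply IH.
Qed.

Lemma Ck_opp n f : Ck n f -> Ck n (fun x => - f x).
Proof.
  intros Hf.
  replace (fun x => - f x) with (fun x => (-1) * f x).
  - apply Ck_mult; [apply Ck_const | exact Hf].
  - apply functional_extensionality; intros x; ring.
Qed.

Lemma Ck_inv n f : (forall x, f x <> 0) -> Ck n f -> Ck n (fun x => / f x).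
Proof.
  intros Hnz; induction n as [|n IH]; intros Hf.
  - intros x; apply (continuous_comp f Rinv); [apply Hf|].
    now apply continuous_Rinv.
  - pose proof (IH (Ck_pred _ _ Hf)) as Hi.
    destruct Hf as [Df Hf].
    (* The derivative contains [/ f] itself, but only at order [n], which [Hi] supplies. The square
       root below is handled in the same way. *)
    apply (Ck_primitive _ _ (fun x => - Derive f x * (/ f x * / f x))).
    + intros x.
      replace (- Derive f x * (/ f x * / f x)) with (- Derive f x / f x ^ 2)
        by (field; apply Hnz).
      apply (is_derive_inv f); [now apply Derive_correct | apply Hnz].
    + apply Ck_mult; [now apply Ck_opp | now apply Ck_mult].
Qed.

Lemma Ck_sqrt n f : (forall x, 0 < f x) -> Ck n f -> Ck n (fun x => sqrt (f x)).
Proof.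
  intros Hpos; induction n as [|n IH]; intros Hf.
  - intros x; apply (continuous_comp f sqrt); [apply Hf|].
    apply continuous_sqrt.
  - pose proof (IH (Ck_pred _ _ Hf)) as Hi.
    destruct Hf as [Df Hf].
    apply (Ck_primitive _ _ (fun x => Derive f x * / (2 * sqrt (f x)))).
    + intros x; apply (is_derive_sqrt f); [now apply Derive_correct | apply Hpos].
    + apply Ck_mult; [exact Hf|].
      apply Ck_inv; [|apply Ck_mult; [apply Ck_const | exact Hi]].
      intros x; pose proof (sqrt_lt_R0 _ (Hpos x)); lra.
Qed.

(** Continuity of each derivative comes from the existence of the next one; quantifying over [k]
    lets the induction move to [S k]. *)
Lemma smooth_Ck_Derive_n g : smooth g -> forall n k, Ck n (Derive_n g k).
Proof.
  intros Hg n; induction n as [|n IH]; intros k.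
  - intros x; apply (ex_derive_continuous (Derive_n g k)), (Hg (S k)).
  - split; [intros x; apply (Hg (S k)) | apply (IH (S k))].
Qed.

Lemma Ck_Derive_n n k g : Ck (k + n) g -> Ck n (Derive_n g k).
Proof.
  revert n; induction k as [|k IH]; intros n Hg; [exact Hg|].
  apply (IH (S n)).
  now rewrite Nat.add_succ_r.
Qed.

Lemma smooth_of_Ck g : (forall n, Ck n g) -> smooth g.
Proof.
  intros Hg [|k] y; [exact I|].
  apply (Ck_Derive_n 1 k g (Hg _)).
Qed.

(** * Calculus of periodic functions *)

Lemma Derive_periodic1 g : periodic1 g -> periodic1 (Derive g).
Proof.
  intros Hg y; unfold Derive; f_equal; f_equal.
  apply functional_extensionality; intros h.
  replace (y + 1 + h) with (y + h + 1) by ring.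
  now rewrite !Hg.
Qed.

Lemma Derive_zero_const g :
  (forall x, is_derive g x 0) -> forall x y, g x = g y.
Proof.
  intros Hg x y.
  destruct (MVT_gen g x y (fun _ => 0)) as [z [_ Hz]].
  - intros z _; apply Hg.
  - intros z _; apply continuity_pt_filterlim.
    apply (ex_derive_continuous g); now exists 0.
  - lra.
Qed.

(** Such a [g] is affine, and comparing its values at 0 and 1 forces the slope [d] to vanish. *)
Lemma periodic1_Derive2_zero_const g :
  periodic1 g -> Ck 2 g -> (forall y, Derive (Derive g) y = 0) ->
  forall x y, g x = g y.
Proof.
  intros Hp [D1 [D2 _]] H0.
  set (d := Derive g 0).
  assert (Hd : forall x, Derive g x = d).
  { intros x; apply (Derive_zero_const (Derive g)); intros z.
    rewrite <- (H0 z); now apply Derive_correct. }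
  assert (Hl : forall x y, g x - d * x = g y - d * y).
  { apply (Derive_zero_const (fun x => g x - d * x)); intros x.
    auto_derive; [repeat split; apply D1|].
    change (Derive (fun x0 => g x0) x) with (Derive g x).
    rewrite Hd; ring. }
  assert (Hd0 : d = 0).
  { pose proof (Hl (0 + 1) 0) as H1; rewrite Hp in H1; lra. }
  intros x y; pose proof (Hl x y) as H1; rewrite Hd0 in H1; lra.
Qed.

Lemma periodic1_Rolle g :
  periodic1 g -> (forall x, ex_derive g x) -> exists y, Derive g y = 0.
Proof.
  intros Hp Hd.
  destruct (MVT_gen g 0 (0 + 1) (Derive g)) as [z [_ Hz]].
  - intros x _; now apply Derive_correct.
  - intros x _; apply continuity_pt_filterlim.
    now apply (ex_derive_continuous g).
  - exists z; rewrite Hp in Hz; lra.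
Qed.

Lemma RInt_periodic1 (g : R -> R) : periodic1 g -> (forall x, continuous g x) ->
  forall x, RInt g x (x + 1) = RInt g 0 1.
Proof.
  intros Hp Hc x.
  assert (Hi : forall a b, ex_RInt g a b).
  { intros a b; apply (ex_RInt_continuous g); intros z _; apply Hc. }
  assert (Hs : RInt g 1 (x + 1) = RInt g 0 x).
  { transitivity (RInt (fun y => g (y + 1)) 0 x).
    - transitivity (RInt g (1 * 0 + 1) (1 * x + 1)); [f_equal; ring|].
      rewrite <- (RInt_comp_lin g 1 1 0 x) by apply Hi.
      apply RInt_ext; intros y _.
      unfold scal; simpl; unfold mult; simpl; rewrite !Rmult_1_l; reflexivity.
    - now apply RInt_ext; intros y _. }
  pose proof (RInt_Chasles g 0 x (x + 1) (Hi _ _) (Hi _ _)) as H1.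
  pose proof (RInt_Chasles g 0 1 (x + 1) (Hi _ _) (Hi _ _)) as H2.
  unfold plus in H1, H2; simpl in H1, H2.
  rewrite Hs in H2; lra.
Qed.

(** The increment of a primitive over a period is the mean of [g], which is zero. Subtracting the
    mean of [G0] gives the primitive zero mean too, so the lemma can be applied twice in a row. *)
Lemma periodic1_primitive (g : R -> R) :
  periodic1 g -> (forall x, continuous g x) -> RInt g 0 1 = 0 ->
  exists G, periodic1 G /\ RInt G 0 1 = 0 /\ forall x, is_derive G x (g x).
Proof.
  intros Hp Hc H0.
  assert (Hi : forall a b, ex_RInt g a b).
  { intros a b; apply (ex_RInt_continuous g); intros z _; apply Hc. }
  set (G0 := fun x => RInt g 0 x).
  assert (D0 : forall x, is_derive G0 x (g x)).
  { intros x; apply (is_derive_RInt g G0 0 x); [|apply Hc].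
    apply filter_forall; intros z; apply (RInt_correct g), Hi. }
  assert (I0 : ex_RInt G0 0 1).
  { apply (ex_RInt_continuous G0); intros z _.
    apply (ex_derive_continuous G0); exists (g z); apply D0. }
  exists (fun x => G0 x - RInt G0 0 1); split; [|split].
  - intros x; unfold G0.
    pose proof (RInt_Chasles g 0 x (x + 1) (Hi _ _) (Hi _ _)) as H1.
    unfold plus in H1; simpl in H1.
    rewrite (RInt_periodic1 g Hp Hc) in H1; lra.
  - rewrite (RInt_minus G0 (fun _ => RInt G0 0 1)); [|exact I0|apply ex_RInt_const].
    rewrite RInt_const; unfold minus, plus, opp, scal; simpl; unfold mult; simpl; ring.
  - intros x.
    replace (g x) with (g x - 0) by ring.
    apply (is_derive_minus G0 (fun _ => RInt G0 0 1)); [apply D0|].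
    apply (is_derive_const (RInt G0 0 1)).
Qed.

(** * The profile function and its inverse near zero *)

Lemma lipschitz_continuous T k :
  0 < k -> (forall v w, Rabs (T v - T w) <= k * Rabs (v - w)) ->
  forall w, continuous T w.
Proof.
  intros Hk Hlip w; apply continuity_pt_filterlim; intros eps Heps.
  exists (eps / k); split; [apply Rdiv_lt_0_compat; lra|].
  intros v [_ Hv]; simpl in *; unfold R_dist in *.
  eapply Rle_lt_trans; [apply Hlip|].
  rewrite Rmult_comm; now apply Rlt_div_r.
Qed.

Definition profile (r s : R) : R := 2 * s / (1 + s ^ 2) - r ^ 2 * s.

(** The difference quotient of [profile r] with the factor [x - y] cancelled; on the diagonal it is
    the derivative. *)
Definition profile_slope (r x y : R) : R :=
  2 * (1 - x * y) / ((1 + x ^ 2) * (1 + y ^ 2)) - r ^ 2.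

Lemma one_plus_sq_pos x : 0 < 1 + x ^ 2.
Proof. nra. Qed.

Lemma profile_sub r x y :
  profile r x - profile r y = profile_slope r x y * (x - y).
Proof.
  unfold profile, profile_slope.
  pose proof (one_plus_sq_pos x); pose proof (one_plus_sq_pos y).
  field; split; lra.
Qed.

(** The numerator is at least 3/2 and the denominator at most 25/16, so the fraction is at least
    24/25, while [r ^ 2] is below 9/100. *)
Lemma profile_slope_ge r x y :
  0 < r < 3 / 10 -> -1/2 <= x <= 1/2 -> -1/2 <= y <= 1/2 ->
  1/2 <= profile_slope r x y.
Proof.
  intros Hr Hx Hy; unfold profile_slope.
  assert (Hx2 : 0 <= x ^ 2 <= 1/4) by nra.
  assert (Hy2 : 0 <= y ^ 2 <= 1/4) by nra.
  assert (Hxy : x * y <= 1/4) by nra.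
  assert (Hd : 0 < (1 + x ^ 2) * (1 + y ^ 2) <= 25/16) by nra.
  assert (24/25 <= 2 * (1 - x * y) / ((1 + x ^ 2) * (1 + y ^ 2))).
  { apply -> Rle_div_r; lra. }
  assert (r ^ 2 < 9/100) by nra; lra.
Qed.

Lemma profile_inj r x y :
  0 < r < 3 / 10 -> -1/2 <= x <= 1/2 -> -1/2 <= y <= 1/2 ->
  profile r x = profile r y -> x = y.
Proof.
  intros Hr Hx Hy He.
  pose proof (profile_sub r x y); pose proof (profile_slope_ge r x y Hr Hx Hy).
  nra.
Qed.

Lemma profile_continuous r x : continuous (profile r) x.
Proof.
  apply (ex_derive_continuous (profile r)); unfold profile.
  auto_derive; pose proof (one_plus_sq_pos x); simpl in *; lra.
Qed.

(** Clamping the argument to [[-7/10, 7/10]] makes [T] total and globally Lipschitz. The endpoint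
    values of [profile r] are plus or minus [4/5 - r ^ 2 / 2], beyond 7/10 in size, and the
    Lipschitz constant 2 is the reciprocal of the slope bound. *)
Lemma profile_inverse r : 0 < r < 3 / 10 ->
  exists T : R -> R,
    (forall w, -1/2 <= T w <= 1/2)
    /\ (forall w, -7/10 <= w <= 7/10 -> profile r (T w) = w)
    /\ (forall v w, Rabs (T v - T w) <= 2 * Rabs (v - w)).
Proof.
  intros Hr.
  set (cl := fun w => Rmax (-7/10) (Rmin w (7/10))).
  assert (Hcl : forall w, -7/10 <= cl w <= 7/10).
  { intros w; unfold cl, Rmax, Rmin; repeat destruct Rle_dec; lra. }
  assert (Hex : forall w, exists s, -1/2 <= s <= 1/2 /\ profile r s = cl w).
  { intros w.
    destruct (IVT_gen (profile r) (-1/2) (1/2) (cl w)) as [s [Hs1 Hs2]].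
    - intros x; apply continuity_pt_filterlim, profile_continuous.
    - assert (Hl : profile r (-1/2) = - (4/5) + r ^ 2 / 2) by (unfold profile; field).
      assert (Hu : profile r (1/2) = 4/5 - r ^ 2 / 2) by (unfold profile; field).
      assert (r ^ 2 < 9/100) by nra.
      rewrite Rmin_left, Rmax_right by lra.
      pose proof (Hcl w); lra.
    - rewrite Rmin_left, Rmax_right in Hs1 by lra.
      now exists s. }
  exists (fun w => proj1_sig (constructive_indefinite_description _ (Hex w))).
  split; [|split].
  - intros w; destruct constructive_indefinite_description as [s [Hs1 Hs2]]; exact Hs1.
  - intros w Hw; destruct constructive_indefinite_description as [s [Hs1 Hs2]]; simpl.
    rewrite Hs2; unfold cl; rewrite Rmin_left, Rmax_right; lra.
  - intros v w.
    destruct constructive_indefinite_description as [s [Hs1 Hs2]].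
    destruct constructive_indefinite_description as [t [Ht1 Ht2]]; simpl.
    assert (Hlip : Rabs (cl v - cl w) <= Rabs (v - w)).
    { unfold cl, Rmax, Rmin, Rabs; repeat destruct Rle_dec; repeat destruct Rcase_abs; lra. }
    pose proof (profile_sub r s t) as Hd.
    pose proof (profile_slope_ge r s t Hr Hs1 Ht1) as Hq.
    rewrite Hs2, Ht2 in Hd.
    rewrite Hd, Rabs_mult, (Rabs_pos_eq (profile_slope r s t)) in Hlip by lra.
    pose proof (Rabs_pos (s - t)); nra.
Qed.

(** The difference quotient of [T] is exactly the reciprocal of [profile_slope], whose limit follows
    from continuity of [T]. The resulting formula involves only [T], which allows bootstrapping to
    all orders. *)
Lemma profile_inverse_derive r T : 0 < r < 3 / 10 ->
  (forall w, -1/2 <= T w <= 1/2) ->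
  (forall w, -7/10 <= w <= 7/10 -> profile r (T w) = w) ->
  (forall v w, Rabs (T v - T w) <= 2 * Rabs (v - w)) ->
  forall w, -7/10 < w < 7/10 -> is_derive T w (/ profile_slope r (T w) (T w)).
Proof.
  intros Hr Hb Hinv Hlip w Hw.
  assert (HT : continuous T w) by (apply (lipschitz_continuous T 2); [lra | exact Hlip]).
  assert (Hq : forall v, 1/2 <= profile_slope r (T v) (T w)).
  { intros v; apply profile_slope_ge; auto. }
  assert (Hc : continuous (fun v => / profile_slope r (T v) (T w)) w).
  { apply (continuous_comp T (fun x => / profile_slope r x (T w))); [exact HT|].
    apply (ex_derive_continuous (fun x => / profile_slope r x (T w))).
    pose proof (Hq w) as Hqw.
    pose proof (one_plus_sq_pos (T w)).
    unfold profile_slope in *; auto_derive.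
    split; [|split; [|exact I]].
    - simpl in *; nra.
    - simpl in *; lra. }
  apply is_derive_Reals; intros eps Heps.
  apply continuity_pt_filterlim in Hc.
  destruct (Hc eps Heps) as [d [Hd Hcd]].
  (* The last two bounds keep [w + h] where [T] genuinely inverts [profile r], away from the clamped
     region. *)
  assert (Hm : 0 < Rmin d (Rmin (w + 7/10) (7/10 - w)))
    by (repeat apply Rmin_pos; lra).
  exists (mkposreal _ Hm); intros h Hh Hhd; simpl in Hhd.
  pose proof (Rmin_l d (Rmin (w + 7/10) (7/10 - w))).
  pose proof (Rmin_r d (Rmin (w + 7/10) (7/10 - w))).
  pose proof (Rmin_l (w + 7/10) (7/10 - w)).
  pose proof (Rmin_r (w + 7/10) (7/10 - w)).
  assert (Hhr : - (w + 7/10) < h < 7/10 - w).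
  { apply Rabs_def2 in Hhd; lra. }
  pose proof (profile_sub r (T (w + h)) (T w)) as Hs.
  rewrite !Hinv in Hs by lra.
  pose proof (Hq (w + h)) as Hqh.
  assert (He : (T (w + h) - T w) / h = / profile_slope r (T (w + h)) (T w)).
  { apply (Rmult_eq_reg_r (h * profile_slope r (T (w + h)) (T w))).
    - field_simplify; [lra | lra | lra].
    - apply Rmult_integral_contrapositive; lra. }
  rewrite He.
  apply (Hcd (w + h)); split; [split; [exact I | lra]|].
  simpl; unfold R_dist; replace (w + h - w) with h by ring; lra.
Qed.

(** * The half-angle substitution and the choice of branch *)

(** With [h = r sin theta] and [theta] acute, the root is [cos theta], and [s] is [sin theta / (1 +
    cos theta) = tan (theta / 2)]. *)
Lemma half_angle r h : 0 < r -> 0 < h < r ->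
  let s := h / (1 + sqrt (1 - 1 / r ^ 2 * h ^ 2)) / r in
  0 < s < 1 /\ 2 * r * s = h * (1 + s ^ 2).
Proof.
  intros Hr Hh s.
  assert (Ht : 0 < h / r < 1).
  { split; [apply Rdiv_lt_0_compat; lra | apply <- Rlt_div_l; lra]. }
  assert (He : 1 - 1 / r ^ 2 * h ^ 2 = 1 - (h / r) ^ 2) by (field; lra).
  subst s; rewrite He.
  assert (Hp : 0 <= 1 - (h / r) ^ 2) by nra.
  pose proof (sqrt_pos (1 - (h / r) ^ 2)) as Hq0.
  pose proof (pow2_sqrt _ Hp) as Hq.
  set (q := sqrt (1 - (h / r) ^ 2)) in *.
  replace (h / (1 + q) / r) with ((h / r) / (1 + q)) by (field; lra).
  assert (Hrt : h = r * (h / r)) by (field; lra).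
  set (t := h / r) in *; clearbody q t.
  split; [split|].
  - apply Rdiv_lt_0_compat; lra.
  - apply <- Rlt_div_l; lra.
  - field_simplify_eq; [|lra].
    replace (q ^ 2) with (1 - t ^ 2) by lra; rewrite Hrt; ring.
Qed.

Lemma half_angle_converse r s : 0 < r -> 0 <= s < 1 ->
  let h := 2 * r * s / (1 + s ^ 2) in
  h < r /\ h / (1 + sqrt (1 - 1 / r ^ 2 * h ^ 2)) = r * s.
Proof.
  intros Hr Hs h.
  assert (H1 : 0 < 1 + s ^ 2) by nra.
  (* This is [cos theta] in terms of [s]; it is nonnegative because [s < 1], so the square root
     returns it with the right sign. *)
  assert (Hq : sqrt (1 - 1 / r ^ 2 * h ^ 2) = (1 - s ^ 2) / (1 + s ^ 2)).
  { apply sqrt_lem_1.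
    - replace (1 - 1 / r ^ 2 * h ^ 2) with (((1 - s ^ 2) / (1 + s ^ 2)) ^ 2)
        by (unfold h; field; lra).
      apply pow2_ge_0.
    - apply -> Rle_div_r; nra.
    - unfold h; field; lra. }
  split.
  - unfold h; apply <- Rlt_div_l; [|lra].
    pose proof (Rmult_lt_0_compat r ((1 - s) * (1 - s)) Hr ltac:(nra)); nra.
  - rewrite Hq; unfold h; field; nra.
Qed.

(** For [s] between 1/2 and 1, [2 * s / (1 + s ^ 2)] is at least 8/10 and [r ^ 2 * s] is below
    9/100, so the profile would exceed 6/10. *)
Lemma profile_small r s : 0 < r < 3 / 10 -> 0 < s < 1 ->
  profile r s < 6/10 -> s <= 1/2.
Proof.
  intros Hr Hs Hp; apply Rnot_lt_le; intros Hl.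
  assert (8/10 <= 2 * s / (1 + s ^ 2)) by (apply -> Rle_div_r; nra).
  unfold profile in Hp.
  assert (r ^ 2 < 9/100) by nra. nra.
Qed.

(** * Solving the profile equation with prescribed mean *)

(** Here [a] stands for [|F|^2], and [K + r * s y - 1] is the future [f''], whose zero mean makes it
    integrable to a periodic function. *)
Lemma profile_solution_family r a :
  0 < r < 3 / 10 -> periodic1 a -> (forall n, Ck n a) ->
  (forall y, 0 <= a y <= r ^ 2) ->
  exists K s, 0 < K /\ periodic1 s /\ (forall n, Ck n s)
    /\ (forall y, 0 <= s y <= 1/2)
    /\ (forall y, profile r (s y) = r * K + a y / r)
    /\ RInt (fun y => K + r * s y - 1) 0 1 = 0.
Proof.
  intros Hr Hper Ha Hab.
  destruct (profile_inverse r Hr) as [T [Tb [Tinv Tlip]]].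
  pose proof (profile_inverse_derive r T Hr Tb Tinv Tlip) as Tder.
  assert (Hq0 : forall w, 1/2 <= profile_slope r (T w) (T w))
    by (intros w; apply profile_slope_ge; auto).
  set (w := fun K y => r * K + a y / r).
  (* Both terms of [w K y] are at most [r < 3/10], so their sum lies in the range where [T] inverts
     [profile r]. *)
  assert (Hw : forall K y, 0 <= K <= 1 -> 0 <= w K y < 6/10).
  { intros K y HK; unfold w.
    assert (0 <= a y / r <= r).
    { specialize (Hab y); split; [apply Rdiv_le_0_compat; lra|].
      apply Rle_div_l; [lra | nra]. }
    nra. }
  assert (HT0 : forall v, 0 <= v < 6/10 -> 0 <= T v).
  { intros v Hv.
    pose proof (profile_sub r (T v) 0) as Hs.
    pose proof (profile_slope_ge r (T v) 0 Hr (Tb v) ltac:(lra)) as Hq.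
    rewrite Tinv in Hs by lra.
    replace (profile r 0) with 0 in Hs by (unfold profile; field).
    nra. }
  assert (Tc : forall v, continuous T v)
    by (apply (lipschitz_continuous T 2); [lra | exact Tlip]).
  assert (wc : forall K y, continuous (w K) y).
  { intros K.
    apply (Ck_plus 0 (fun _ => r * K) (fun y => a y * / r));
      [apply Ck_const | apply Ck_mult; [apply Ha | apply Ck_const]]. }
  set (phi := fun K y => K + r * T (w K y)).
  assert (phic : forall K y, continuous (phi K) y).
  { intros K.
    apply (Ck_plus 0 (fun _ => K) (fun y => r * T (w K y))); [apply Ck_const|].
    apply (Ck_mult 0 (fun _ => r)); [apply Ck_const|].
    intros y; apply (continuous_comp (w K) T); [apply wc | apply Tc]. }
  assert (phii : forall K, ex_RInt (phi K) 0 1)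
    by (intros K; apply (ex_RInt_continuous (phi K)); auto).
  set (Psi := fun K => RInt (phi K) 0 1).
  (* [Psi] is Lipschitz with constant [1 + 2 * r ^ 2 <= 2], for all real [K] because [T] is globally
     Lipschitz; hence the choice [eps / 2]. *)
  assert (Psic : continuity Psi).
  { intros K eps Heps; exists (eps / 2); split; [lra|].
    intros L [_ HL]; simpl in *; unfold R_dist in *.
    unfold Psi; rewrite <- (RInt_minus (phi L) (phi K)) by apply phii.
    apply Rle_lt_trans with ((1 - 0) * (2 * Rabs (L - K))); [|lra].
    apply abs_RInt_le_const; [lra | apply (ex_RInt_minus (phi L) (phi K)); apply phii|].
    intros y _; unfold minus, plus, opp; simpl; unfold phi.
    replace (L + r * T (w L y) + - (K + r * T (w K y)))
      with ((L - K) + r * (T (w L y) - T (w K y))) by ring.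
    eapply Rle_trans; [apply Rabs_triang|].
    rewrite Rabs_mult, (Rabs_pos_eq r) by lra.
    pose proof (Tlip (w L y) (w K y)) as Hl.
    replace (w L y - w K y) with (r * (L - K)) in Hl by (unfold w; ring).
    rewrite Rabs_mult, (Rabs_pos_eq r) in Hl by lra.
    pose proof (Rabs_pos (L - K)).
    assert (r * Rabs (T (w L y) - T (w K y)) <= r * (2 * (r * Rabs (L - K))))
      by (apply Rmult_le_compat_l; lra).
    assert (r * r <= 1/2) by nra.
    assert (r * (2 * (r * Rabs (L - K))) <= Rabs (L - K)) by nra.
    lra. }
  assert (P0 : Psi 0 < 1).
  { unfold Psi.
    apply Rle_lt_trans with (RInt (fun _ => r / 2) 0 1).
    - apply RInt_le; [lra | apply phii | apply ex_RInt_const|].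
      intros y _; unfold phi; specialize (Tb (w 0 y)); nra.
    - rewrite RInt_const; unfold scal; simpl; unfold mult; simpl; lra. }
  assert (P1 : 1 <= Psi 1).
  { unfold Psi.
    apply Rle_trans with (RInt (fun _ => 1) 0 1).
    - rewrite RInt_const; unfold scal; simpl; unfold mult; simpl; lra.
    - apply RInt_le; [lra | apply ex_RInt_const | apply phii|].
      intros y _; unfold phi.
      pose proof (HT0 (w 1 y) ltac:(apply Hw; lra)); nra. }
  destruct (IVT_gen Psi 0 1 1 Psic) as [K [HK HK1]].
  { rewrite Rmin_left, Rmax_right by lra; lra. }
  rewrite Rmin_left, Rmax_right in HK by lra.
  (* The strict inequality [P0] rules out [K = 0]. Positivity of [1 + f''] will rest on this, since
     [s] is only known to be nonnegative. *)
  assert (HKpos : 0 < K).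
  { destruct (Rle_lt_or_eq_dec 0 K ltac:(lra)) as [H|<-]; lra. }
  exists K, (fun y => T (w K y)).
  split; [exact HKpos|]; split; [|split; [|split; [|split]]].
  - intros y; unfold w; now rewrite Hper.
  - intros n; induction n as [|n IH].
    + intros y; apply (continuous_comp (w K) T); [apply wc | apply Tc].
    + destruct (Ha (S n)) as [Da Ha'].
      (* By the chain rule the derivative is [Derive a] times a rational expression in [T (w K y)],
         which is already [Ck n] by induction. *)
      apply (Ck_primitive _ _ (fun y =>
        (Derive a y * / r) * / profile_slope r (T (w K y)) (T (w K y)))).
      * intros y; apply (is_derive_comp T (w K)).
        -- apply Tder; pose proof (Hw K y HK); lra.
        -- unfold w; auto_derive; [apply Da|].
           change (Derive (fun x => a x) y) with (Derive a y); field; lra.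
      * assert (Hsq : Ck n (fun y => T (w K y) * T (w K y))) by now apply Ck_mult.
        assert (Hi : Ck n (fun y => / (1 + T (w K y) * T (w K y)))).
        { apply Ck_inv; [intros y; pose proof (Rle_0_sqr (T (w K y))); unfold Rsqr in *; lra|].
          apply Ck_plus; [apply Ck_const | exact Hsq]. }
        apply Ck_mult; [apply Ck_mult; [exact Ha' | apply Ck_const]|].
        apply Ck_inv; [intros y; specialize (Hq0 (w K y)); lra|].
        replace (fun y => profile_slope r (T (w K y)) (T (w K y)))
          with (fun y => 2 * (1 + - (T (w K y) * T (w K y)))
            * (/ (1 + T (w K y) * T (w K y)) * / (1 + T (w K y) * T (w K y)))
            + - r ^ 2).
        -- apply Ck_plus; [|apply Ck_const].
           apply Ck_mult; [|now apply Ck_mult].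
           apply Ck_mult; [apply Ck_const|].
           apply Ck_plus; [apply Ck_const | now apply Ck_opp].
        -- apply functional_extensionality; intros y; unfold profile_slope.
           field; pose proof (one_plus_sq_pos (T (w K y))); simpl in *; lra.
  - intros y; pose proof (HT0 (w K y) (Hw K y HK)); specialize (Tb (w K y)); lra.
  - intros y; apply Tinv; pose proof (Hw K y HK) as H; unfold w in H; lra.
  - change (RInt (fun y => minus (phi K y) 1) 0 1 = 0).
    rewrite (RInt_minus (phi K) (fun _ => 1)); [|apply phii|apply ex_RInt_const].
    change (RInt (phi K) 0 1) with (Psi K).
    rewrite HK1, RInt_const.
    unfold minus, plus, opp, scal; simpl; unfold mult; simpl; ring.
Qed.

(** * Existence: from the profile equation to a potential *)

Lemma Cmod_sqr z : Cmod z ^ 2 = Re z * Re z + Im z * Im z.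
Proof.
  unfold Cmod; rewrite pow2_sqrt; [unfold Re, Im; ring | nra].
Qed.

Lemma Ck_Cmod_sqr F : circle_smoothC F -> forall n, Ck n (fun y => Cmod (F y) ^ 2).
Proof.
  intros [_ [HR HI]] n.
  replace (fun y => Cmod (F y) ^ 2)
    with (fun y => Re (F y) * Re (F y) + Im (F y) * Im (F y)).
  - apply Ck_plus; apply Ck_mult;
      first [apply (smooth_Ck_Derive_n _ HR n 0) | apply (smooth_Ck_Derive_n _ HI n 0)].
  - apply functional_extensionality; intros y; now rewrite Cmod_sqr.
Qed.

Lemma moment_map_solution_exists c F :
  c <> RtoC 0 -> circle_smoothC F -> (forall y, Cmod (F y) <= Cmod c) ->
  Cmod c < 3 / 10 -> exists f, moment_map_solution c F f.
Proof.
  intros hc hF hFc hc310.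
  pose proof (proj1 (Cmod_gt_0 c) hc) as hr.
  set (r := Cmod c) in *.
  destruct (profile_solution_family r (fun y => Cmod (F y) ^ 2))
    as [K [s [HK [Hsp [Hsk [Hsb [Hse Hsi]]]]]]].
  - lra.
  - intros y; now rewrite (proj1 hF).
  - now apply Ck_Cmod_sqr.
  - intros y; specialize (hFc y); pose proof (Cmod_ge_0 (F y)); nra.
  - set (psi := fun y => K + r * s y - 1) in *.
    assert (Cpsi : forall n, Ck n psi).
    { intros n; apply Ck_plus; [|apply Ck_const].
      apply Ck_plus; [apply Ck_const | apply Ck_mult; [apply Ck_const | apply Hsk]]. }
    assert (Ppsi : periodic1 psi) by (intros y; unfold psi; now rewrite Hsp).
    destruct (periodic1_primitive psi Ppsi (Cpsi 0%nat) Hsi) as [f' [P1 [I1 D1]]].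
    assert (C1 : forall n, Ck n f')
      by (intros n; apply Ck_pred, (Ck_primitive _ _ psi); auto).
    destruct (periodic1_primitive f' P1 (C1 0%nat) I1) as [f [P [_ D]]].
    assert (E2 : forall y, Derive_n f 2 y = psi y).
    { intros y; simpl.
      rewrite (Derive_ext (fun x => Derive (fun z => f z) x) f').
      - apply is_derive_unique, D1.
      - intros z; apply is_derive_unique, D. }
    (* Multiplying the profile equation by [r] identifies the Higgs term with [r sin theta], so the
       converse half-angle formula applies and the moment function is [r s - (K + r s) = - K]. *)
    assert (Eh : forall y, higgs_term c F f y = 2 * r * s y / (1 + s y ^ 2)).
    { intros y; unfold higgs_term; rewrite E2; unfold psi; fold r.
      specialize (Hse y); unfold profile in Hse.
      replace (K + r * s y - 1) with (K + r * s y + -1) by ring.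
      replace (Cmod (F y) ^ 2) with (r * (Cmod (F y) ^ 2 / r)) by (field; lra).
      replace (Cmod (F y) ^ 2 / r)
        with (2 * s y / (1 + s y ^ 2) - r ^ 2 * s y - r * K) by lra.
      field; nra. }
    assert (Hh : forall y, higgs_term c F f y < r
      /\ moment_fun c F f y = - K).
    { intros y; unfold moment_fun; fold r; rewrite Eh, E2.
      destruct (half_angle_converse r (s y) hr) as [A B].
      - specialize (Hsb y); lra.
      - split; [exact A|]; rewrite B; unfold psi; ring. }
    exists f; split; [split|split; [|split]].
    + exact P.
    + apply smooth_of_Ck; intros n; apply Ck_pred, (Ck_primitive _ _ f'); auto.
    + intros y; rewrite E2; unfold psi; specialize (Hsb y); nra.
    + intros y; apply Hh.
    + intros y; rewrite (Derive_n_ext _ (fun _ => - K)) by apply Hh.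
      rewrite (Derive_n_const 1); reflexivity.
Qed.

(** * Every solution satisfies the profile equation *)

Lemma moment_map_solution_profile c F f :
  c <> RtoC 0 -> circle_smoothC F -> (forall y, Cmod (F y) <= Cmod c) ->
  Cmod c < 3 / 10 -> moment_map_solution c F f ->
  exists K s, (forall y, 0 < s y <= 1/2)
    /\ (forall y, profile (Cmod c) (s y) = Cmod c * K + Cmod (F y) ^ 2 / Cmod c)
    /\ (forall y, 1 + Derive_n f 2 y = K + Cmod c * s y).
Proof.
  intros hc hF hFc hc310 [[Pf Sf] [Hpos [Hlt Hmom]]].
  pose proof (proj1 (Cmod_gt_0 c) hc) as hr.
  pose proof (smooth_Ck_Derive_n f Sf) as Cf.
  pose proof (Ck_Cmod_sqr F hF) as CF.
  assert (Hh : forall y, 0 < higgs_term c F f y < Cmod c).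
  { intros y; split; [|apply Hlt]; unfold higgs_term.
    specialize (Hpos y); pose proof (pow2_ge_0 (Cmod (F y))).
    assert (0 < Cmod c ^ 2) by nra; nra. }
  set (r := Cmod c) in *.
  set (h := higgs_term c F f) in *.
  assert (Hrad : forall y, 0 < 1 + - (1 / r ^ 2 * (h y * h y))).
  { intros y; specialize (Hh y).
    replace (1 / r ^ 2 * (h y * h y)) with ((h y / r) ^ 2) by (field; lra).
    assert (0 < h y / r < 1).
    { split; [apply Rdiv_lt_0_compat; lra | apply <- Rlt_div_l; lra]. }
    nra. }
  assert (Ch : forall n, Ck n h).
  { intros n; apply Ck_plus; [|apply CF].
    apply Ck_mult; [|apply Ck_const].
    apply Ck_plus; [apply Ck_const | apply Cf]. }
  (* A vanishing [Derive_n] yields constancy only with genuine differentiability; the strictly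
     positive radicand [Hrad] provides it. *)
  assert (Cm : Ck 2 (moment_fun c F f)).
  { replace (moment_fun c F f) with (fun y =>
      h y * / (1 + sqrt (1 + - (1 / r ^ 2 * (h y * h y))))
      + - (1 + Derive_n f 2 y)).
    - apply Ck_plus.
      + apply Ck_mult; [apply Ch|]; apply Ck_inv.
        * intros y; pose proof (sqrt_pos (1 + - (1 / r ^ 2 * (h y * h y)))); lra.
        * apply Ck_plus; [apply Ck_const|]; apply Ck_sqrt; [exact Hrad|].
          apply Ck_plus; [apply Ck_const|]; apply Ck_opp, Ck_mult; [apply Ck_const|].
          now apply Ck_mult.
      + apply Ck_opp, Ck_plus; [apply Ck_const | apply Cf].
    - apply functional_extensionality; intros y; unfold moment_fun; fold r h.
      replace (h y ^ 2) with (h y * h y) by ring; reflexivity. }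
  assert (P1 : periodic1 (Derive_n f 1)) by exact (Derive_periodic1 f Pf).
  assert (P2 : periodic1 (Derive_n f 2)) by exact (Derive_periodic1 _ P1).
  assert (Ph : periodic1 h).
  { intros y; unfold h, higgs_term; now rewrite P2, (proj1 hF). }
  assert (Pm : periodic1 (moment_fun c F f)).
  { intros y; unfold moment_fun; fold h; now rewrite Ph, P2. }
  pose proof (periodic1_Derive2_zero_const _ Pm Cm Hmom) as Hconst.
  set (s := fun y => h y / (1 + sqrt (1 - 1 / r ^ 2 * h y ^ 2)) / r).
  set (K := - moment_fun c F f 0).
  assert (Hs : forall y, 0 < s y < 1 /\ 2 * r * s y = h y * (1 + s y ^ 2)).
  { intros y; apply (half_angle r (h y) hr (Hh y)). }
  (* Constancy of the moment function, with value [- K], reads [r s - (1 + f'') = - K]. *)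
  assert (Hphi : forall y, 1 + Derive_n f 2 y = K + r * s y).
  { intros y; unfold K; rewrite (Hconst 0 y); unfold moment_fun, s; fold r h.
    set (q := h y / _); field; lra. }
  assert (Hprof : forall y, profile r (s y) = r * K + Cmod (F y) ^ 2 / r).
  { intros y; destruct (Hs y) as [_ He].
    pose proof (one_plus_sq_pos (s y)).
    assert (He' : 2 * s y / (1 + s y ^ 2) = h y / r).
    { apply (Rmult_eq_reg_r (r * (1 + s y ^ 2))); [field_simplify; lra | nra]. }
    unfold profile; rewrite He'.
    unfold h, higgs_term; fold r; rewrite Hphi; field; lra. }
  (* By Rolle [f''] vanishes somewhere, so [K < 1] and the right-hand side
     [r K + |F|^2 / r] stays below [2 r < 6 / 10]. *)
  destruct (periodic1_Rolle (Derive_n f 1) P1) as [y0 Hy0].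
  { exact (proj1 (Cf 1%nat 1%nat)). }
  assert (HK : K < 1).
  { pose proof (Hphi y0) as H0; change (Derive_n f 2 y0) with (Derive (Derive_n f 1) y0) in H0.
    rewrite Hy0 in H0; destruct (Hs y0) as [Hs0 _]; nra. }
  exists K, s; split; [|split; [exact Hprof | exact Hphi]].
  intros y; destruct (Hs y) as [Hsy _]; split; [lra|].
  apply (profile_small r); [lra | exact Hsy|].
  rewrite Hprof.
  assert (Cmod (F y) ^ 2 / r <= r).
  { apply Rle_div_l; [lra|]; specialize (hFc y).
    pose proof (Cmod_ge_0 (F y)); fold r in hFc; nra. }
  nra.
Qed.

(** * Uniqueness up to an additive constant *)

Theorem mainTheorem10 (c : C) (F : R -> C)
  (hc : c <> RtoC 0)
  (hF : circle_smoothC F)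
  (hFc : forall y : R, Cmod (F y) <= Cmod c)
  (hc310 : Cmod c < 3 / 10) :
  exists f : R -> R,
    moment_map_solution c F f
    /\ (forall g : R -> R, moment_map_solution c F g ->
          exists k : R, forall y : R, g y = f y + k).
Proof.
  destruct (moment_map_solution_exists c F hc hF hFc hc310) as [f Hf].
  exists f; split; [exact Hf|]; intros g Hg.
  pose proof (proj1 (Cmod_gt_0 c) hc) as hr.
  destruct (moment_map_solution_profile c F f hc hF hFc hc310 Hf)
    as [K [s [Hs [Hps Hfs]]]].
  destruct (moment_map_solution_profile c F g hc hF hFc hc310 Hg)
    as [L [t [Ht [Hpt Hgt]]]].
  destruct Hf as [[Pf Sf] _], Hg as [[Pg Sg] _].
  set (r := Cmod c) in *.
  set (d := fun y => g y - f y).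
  assert (Pd : periodic1 d) by (intros y; unfold d; now rewrite Pg, Pf).
  pose proof (smooth_Ck_Derive_n f Sf) as Cf.
  pose proof (smooth_Ck_Derive_n g Sg) as Cg.
  assert (D1 : Derive d = fun y => Derive g y - Derive f y).
  { apply functional_extensionality; intros y; apply Derive_minus;
      [exact (Sg 1%nat y) | exact (Sf 1%nat y)]. }
  assert (D2 : forall y, Derive (Derive d) y = Derive_n g 2 y - Derive_n f 2 y).
  { intros y; rewrite D1; apply (Derive_minus (Derive g) (Derive f));
      [exact (Sg 2%nat y) | exact (Sf 2%nat y)]. }
  assert (Cd : Ck 2 d).
  { apply (Ck_plus 2 g (fun y => - f y)); [exact (Cg 2%nat 0%nat)|].
    exact (Ck_opp 2 f (Cf 2%nat 0%nat)). }
  assert (Hinj : forall y, r * K = r * L -> s y = t y).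
  { intros y HKL; specialize (Hs y); specialize (Ht y).
    apply (profile_inj r); try lra; rewrite Hps, Hpt; lra. }
  assert (HKL : K = L).
  { destruct (periodic1_Rolle (Derive d) (Derive_periodic1 d Pd)) as [y0 Hy0].
    { exact (proj1 (proj2 Cd)). }
    rewrite D2 in Hy0.
    pose proof (Hfs y0); pose proof (Hgt y0).
    pose proof (profile_sub r (s y0) (t y0)) as Hd; rewrite Hps, Hpt in Hd.
    pose proof (profile_slope_ge r (s y0) (t y0) ltac:(lra)
      ltac:(specialize (Hs y0); lra) ltac:(specialize (Ht y0); lra)).
    (* Equal second derivatives give [r (s - t) = L - K], while the profile equations give slope
       times [s - t] equal to [r (K - L)], that is [- r ^ 2 (s - t)]. The total factor is positive,
       so [s = t] and then [K = L]. *)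
    assert ((profile_slope r (s y0) (t y0) + r ^ 2) * (s y0 - t y0) = 0).
    { rewrite Rmult_plus_distr_r, <- Hd.
      replace (s y0 - t y0) with ((L - K) / r) by (field_simplify_eq; lra).
      field; lra. }
    assert (s y0 = t y0) by nra.
    nra. }
  subst L.
  assert (Hz : forall y, Derive (Derive d) y = 0).
  { intros y; rewrite D2; pose proof (Hfs y); pose proof (Hgt y).
    rewrite (Hinj y eq_refl) in *; lra. }
  exists (d 0); intros y.
  rewrite <- (periodic1_Derive2_zero_const d Pd Cd Hz y 0); unfold d; ring.
Qed.
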